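(* Let $k\geq 2$ and $n\geq k+1$ be integers. For a tuple $(s_1,\dots,s_k)$ of positive integers write $S_i=s_1+\cdots+s_i$ for $i=1,\dots,k-1$. Then $$ \sum_{\substack{s_i\geq 1,\ s_1\geq 2\\ s_1+\cdots+s_{k}=n}} \Big[2^{s_1-1}+(2^{s_1-1}-1)\Big(\sum_{i=2}^{k-1} 2^{S_i-s_1-(i-1)}+ 2^{S_{k-1}-s_1-(k-2)}\Big)\Big]\, \zeta(s_1,\dots, s_{k})=n\,\zeta(n), $$ where the inner sum $\sum_{i=2}^{k-1}$ is empty (zero) when $k=2$.
   Context: For integers $s_1\geq 2$ and $s_2,\dots,s_k\geq 1$, the multiple zeta value is $\zeta(s_1,\dots,s_k)=\sum_{n_1>n_2>\cdots>n_k\geq 1} \frac{1}{n_1^{s_1}\cdots n_k^{s_k}}$; for $k=1$ this is the Riemann zeta value $\zeta(n)$. *)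

(* Defs.v *)
From HB Require Import structures.
From mathcomp Require Import all_boot all_order all_algebra.
From mathcomp Require Import all_classical all_reals all_analysis.
Set Implicit Arguments. Unset Strict Implicit. Unset Printing Implicit Defensive.
Import Order.TTheory GRing.Theory Num.Theory numFieldNormedType.Exports.
Local Open Scope ring_scope.

(* Truncated multiple zeta sum:
   mzv_trunc [:: s1; ...; sk] N = sum_{N >= n1 > n2 > ... > nk >= 1} 1/(n1^s1 ... nk^sk). *)
Fixpoint mzv_trunc (R : realType) (s : seq nat) (N : nat) : R :=
  match s with
  | [::] => 1
  | a :: t => \sum_(1 <= m < N.+1) ((m%:R : R) ^- a) * mzv_trunc R t m.-1
  end.

(* Multiple zeta value zeta(s1,...,sk): the limit of the truncated sums as N -> oo
   (a sum of positive terms; convergent for admissible s, i.e. s1 >= 2). *)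
Definition mzv (R : realType) (s : seq nat) : R := limn (mzv_trunc R s).

Definition zeta (R : realType) (n : nat) : R := mzv R [:: n].

Definition psum (s : seq nat) (i : nat) : nat := \sum_(0 <= j < i) nth 0 s j.

Definition coef (R : realType) (k : nat) (s : seq nat) : R :=
  let s1 := nth 0 s 0 in
  (2%:R : R) ^+ (s1 - 1) +
  ((2%:R : R) ^+ (s1 - 1) - 1) *
    (\sum_(2 <= i < k) (2%:R : R) ^+ (psum s i - s1 - (i - 1))
     + (2%:R : R) ^+ (psum s k.-1 - s1 - (k - 2))).

(* Main.v *)
Require Import Defs.
From HB Require Import structures.
From mathcomp Require Import all_boot all_order all_algebra.
From mathcomp Require Import all_classical all_reals all_analysis.
From mathcomp Require Import ring lra zify.
Set Implicit Arguments. Unset Strict Implicit. Unset Printing Implicit Defensive.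
Import Order.TTheory GRing.Theory Num.Theory numFieldNormedType.Exports.
Local Open Scope ring_scope.

(** Let [x] mark weight minus depth and [y] mark depth, and write
    [p_n = prod_(1 <= j <= n) (1 + y/(j-x))], the generating series of the
    chains [n >= n_1 > n_2 > ...].  Powers of 2 come from factors [1/(m-2x)],
    which the shuffle identity
    [1/((m-x)(n-x)) = (1/(m-x) + 1/(n-x)) / (m+n-2x)] produces.  After
    cancellation, the left-hand side truncated at [N] has the generating series
      [xy sum_(n <= N) p_(n-1)/(n(n-x)) * (1 + y sum_(j <= n) 1/(j-x))],
    up to an error that tends to 0 coefficientwise.  The summand without the
    inner sum telescopes under the shift [(x,y) -> (x-1,y-1)] to
    [sum_m 1/((m-x)(m-y))], which is the sum formula; the inner sum over [j] is
    its logarithmic derivative along [d/dx + d/dy], so the second part sums to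
    the derivative of [sum_m 1/((m-x)(m-y))].  The coefficient of
    [x^(n-k) y^k] in the total is then [n zeta(n)].  Convergence of the truncated
    sums is controlled by a submultiplicative norm on power series. *)

(** * Finite identities *)

(* In this section [d m = 1/m], [u m = 1/(m-x)], [v m = 1/(m-2x)] and
   [w m = 1/(m-y)]; they are kept abstract so that the ring may be one of
   formal power series. *)
Section FiniteIdentities.
Variables (A : comPzRingType) (x y : A) (d u v w : nat -> A).
Hypothesis dK : forall m, d m.+1 * m.+1%:R = 1.
Hypothesis uK : forall m, u m.+1 * (m.+1%:R - x) = 1.
Hypothesis vK : forall m, v m.+1 * (m.+1%:R - (x + x)) = 1.
Hypothesis wK : forall m, w m.+1 * (m.+1%:R - y) = 1.

Definition chain_gf (n : nat) : A := \prod_(j < n) (1 + y * u j.+1).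
(* The part of [chain_gf n] coming from chains whose largest entry is [n]. *)
Definition chain_top (n : nat) : A := y * u n * chain_gf n.-1.
Definition shuffle_gf (n : nat) : A :=
  \sum_(i < n) y * u i.+1 * chain_gf (n - i.+1).
(** Its [y]-coefficients turn out to carry the inner powers of 2 of the theorem, in the form
    [tail_weight]. *)
Definition weight_gf (n : nat) : A := chain_gf n - 1 + shuffle_gf n.
Definition chain_conv (n : nat) : A := \sum_(i < n) u i.+1 * chain_top (n - i).
Definition harm (m n : nat) : A := \sum_(j < n) u (m + j.+1).

Lemma chain_gfS n : chain_gf n.+1 = chain_gf n + chain_top n.+1.
Proof. by rewrite /chain_gf big_ord_recr /= mulrDr mulr1 mulrC. Qed.

Lemma sum_chain_top n : \sum_(i < n) chain_top i.+1 = chain_gf n - 1.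
Proof.
elim: n => [|n IH]; first by rewrite big_ord0 /chain_gf big_ord0 subrr.
by rewrite big_ord_recr /= IH chain_gfS; ring.
Qed.

Lemma sum_chain_top_rev n : \sum_(i < n) chain_top (n - i) = chain_gf n - 1.
Proof.
rewrite -sum_chain_top (reindex_inj rev_ord_inj) /=.
by apply: eq_bigr => i _; rewrite subKn.
Qed.

(* Writing n+1-2x = (m-x) + (n+1-m-x) in each term is the shuffle product in
   partial-fraction form. *)
Lemma chain_convE n :
  (n.+1%:R - (x + x)) * chain_conv n = weight_gf n.
Proof.
rewrite /weight_gf -sum_chain_top_rev /shuffle_gf /chain_conv mulr_sumr -big_split /=.
apply: eq_bigr => i _; have lt_in := ltn_ord i.
have -> : n.+1%:R = i.+1%:R + (n - i)%:R :> A by rewrite -natrD; congr (_%:R); lia.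
have -> : (n - i = (n - i.+1).+1)%N by lia.
have H1 := uK i; have H2 := uK (n - i.+1)%N.
rewrite /chain_top /=; set P := chain_gf _; set a := u i.+1 in H1 *.
set c := u _ in H2 *.
rewrite -[RHS](_ : a * (i.+1%:R - x) * (y * c * P)
   + y * a * P * (c * ((n - i.+1).+1%:R - x)) = _); first by ring.
by rewrite H1 H2; ring.
Qed.

(** Each [chain_gf (n - i)] splits off the chains with largest entry [n - i]; these assemble into
    [chain_conv n]. *)
Lemma shuffle_gfS n :
  shuffle_gf n.+1 = shuffle_gf n + y * u n.+1 + y * chain_conv n.
Proof.
rewrite {1}/shuffle_gf big_ord_recr /= subnn {2}/chain_gf big_ord0 mulr1.
rewrite addrAC; congr (_ + _).
rewrite /shuffle_gf /chain_conv mulr_sumr -big_split /=.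
apply: eq_bigr => i _; have lt_in := ltn_ord i.
rewrite subSS; have -> : (n - i = (n - i.+1).+1)%N by lia.
by rewrite chain_gfS; ring.
Qed.

Lemma v_weight_gf n : v n.+1 * weight_gf n = chain_conv n.
Proof. by rewrite -chain_convE mulrA vK mul1r. Qed.

(** Dividing the shuffle identity by [n+1-2x] expresses the increment of [shuffle_gf] through
    [weight_gf] itself; the factor [v] of this recursion creates the powers of 2. *)
Lemma weight_gf_rec n :
  weight_gf n = (chain_gf n - 1) + \sum_(i < n) y * u i.+1
                + \sum_(i < n) y * v i.+1 * weight_gf i.
Proof.
rewrite {1}/weight_gf -[RHS]addrA; congr (_ + _).
elim: n => [|n IH]; first by rewrite /shuffle_gf !big_ord0 addr0.
by rewrite shuffle_gfS IH !big_ord_recr /= -mulrA v_weight_gf; ring.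
Qed.

(** The part of the left-hand side with [2^(s_1-1) - 1] times the tail weight: [v - u] expands with
    coefficients [(2^a - 1)/m^(a+1)]. *)
Definition diff_gf (n : nat) : A :=
  \sum_(i < n) y * (v i.+1 - u i.+1) * weight_gf i.

Lemma diff_gfE n : diff_gf n = x * y * \sum_(i < n) u i.+1 * chain_conv i.
Proof.
rewrite /diff_gf mulr_sumr; apply: eq_bigr => i _.
rewrite -(v_weight_gf i); have H1 := uK i; have H2 := vK i.
set a := u _ in H1 *; set c := v _ in H2 *.
have -> : c - a = x * (a * c).
  transitivity (c * (a * (i.+1%:R - x)) - a * (c * (i.+1%:R - (x + x)))).
    by rewrite H1 H2 !mulr1.
  by ring.
by ring.
Qed.

Lemma u_sub m n : u m.+1 - u (m + n.+1).+1 = n.+1%:R * (u m.+1 * u (m + n.+1).+1).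
Proof.
have H1 := uK m; have H2 := uK (m + n.+1)%N.
set a := u _ in H1 *; set c := u _ in H2 *.
transitivity (a * (c * ((m + n.+1).+1%:R - x)) - c * (a * (m.+1%:R - x))).
  by rewrite H1 H2 !mulr1.
by rewrite -addSn natrD; ring.
Qed.

Lemma d_u_sub m n : d n.+1 * (u m.+1 - u (m + n.+1).+1) = u m.+1 * u (m + n.+1).+1.
Proof. by rewrite u_sub mulrA dK mul1r. Qed.

Lemma harmS m n : harm m n.+1 = harm m n + u (m + n.+1).
Proof. by rewrite /harm big_ord_recr. Qed.

(** Induction on [n]: the new terms are [u_(n+1) u_(n-i)] times [chain_top], and partial fractions
    turn each into [d_(i+1)] times the change of the window [harm 0 n - harm 0 (n-i-1)]. The window
    contributes only an error term in the limit. *)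
Lemma sum_u_chain_conv n :
  \sum_(i < n) u i.+1 * chain_conv i =
  \sum_(i < n) d i.+1 * chain_top i.+1 *
     (harm 0 i.+1 - (harm 0 n - harm 0 (n - i.+1))).
Proof.
elim: n => [|n IH]; first by rewrite !big_ord0.
rewrite !big_ord_recr /= {}IH subnn [harm 0 0]/harm big_ord0 subr0 subrr mulr0 addr0.
rewrite /chain_conv mulr_sumr [X in _ + X = _](reindex_inj rev_ord_inj) /=.
rewrite -big_split /=.
apply: eq_bigr => i _; have lt_in := ltn_ord i.
rewrite subKn // subSS [harm 0 n.+1]harmS add0n.
have -> : (n - i = (n - i.+1).+1)%N by lia.
rewrite [harm 0 (n - i.+1).+1]harmS add0n.
have := d_u_sub (n - i.+1) i; rewrite (_ : (n - i.+1 + i.+1 = n)%N); last by lia.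
move=> E; set c := chain_top _.
have -> : u n.+1 * (u (n - i.+1).+1 * c) = d i.+1 * (u (n - i.+1).+1 - u n.+1) * c.
  by rewrite E; ring.
ring.
Qed.

(* [csum m i] is the summand [p_(n-1)/(n(n-x))], [n = i+1], of the sum formula
   after the shift [(x,y) -> (x-m,y-m)], which leaves [y-x] unchanged.  The sum
   over [i] of the difference of two consecutive shifts telescopes, with
   remainder [crem]. *)
Definition rise (n : nat) : A := \prod_(j < n) (j.+1%:R + (y - x)).
Definition csum (m i : nat) : A := d i.+1 * rise i * \prod_(j < i.+1) u (m + j.+1).
Definition crem (m n : nat) : A := rise n * \prod_(j < n.+1) u (m + j).

Lemma csum0 i : y * csum 0 i = d i.+1 * chain_top i.+1.
Proof.
rewrite /csum /chain_top big_ord_recr /=; under eq_bigr do rewrite add0n.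
rewrite add0n (_ : chain_gf i = rise i * \prod_(j < i) u j.+1); first by ring.
rewrite -big_split /=; apply: eq_bigr => j _.
rewrite -[X in X + _ = _](uK j); ring.
Qed.

(* The second identity is the derivative of the first one in [x] with [y-x] fixed. *)
Lemma csum_step m n : csum m n - csum m.+1 n = w m.+1 * (crem m.+1 n - crem m.+1 n.+1) /\
  csum m n * harm m n.+1 - csum m.+1 n * harm m.+1 n.+1 =
   crem m.+1 n * (w m.+1 * (\sum_(j < n.+1) u (m.+1 + j)) + w m.+1 ^+ 2)
   - crem m.+1 n.+1 * (w m.+1 * (\sum_(j < n.+2) u (m.+1 + j)) + w m.+1 ^+ 2).
Proof.
pose P := \prod_(j < n) u (m + j.+2).
pose K := \sum_(j < n) u (m + j.+2).
pose a := u m.+1; pose c := u (m + n.+1).+1.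
have P1 : \prod_(j < n.+1) u (m + j.+1) = a * P.
  by rewrite big_ord_recl addn1.
have P2 : \prod_(j < n.+1) u (m.+1 + j.+1) = P * c.
  rewrite big_ord_recr /= addSn; congr (_ * _).
  by apply: eq_bigr => j _; rewrite addSnnS.
have P3 : \prod_(j < n.+1) u (m.+1 + j) = a * P.
  by rewrite -P1; apply: eq_bigr => j _; rewrite addSnnS.
have P4 : \prod_(j < n.+2) u (m.+1 + j) = a * P * c.
  by rewrite big_ord_recr /= P3 addSn.
have K1 : harm m n.+1 = a + K.
  by rewrite /harm big_ord_recl addn1.
have K2 : harm m.+1 n.+1 = K + c.
  rewrite /harm big_ord_recr /= addSn; congr (_ + _).
  by apply: eq_bigr => j _; rewrite addSnnS.
have K3 : \sum_(j < n.+1) u (m.+1 + j) = a + K.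
  by rewrite -K1; apply: eq_bigr => j _; rewrite addSnnS.
have K4 : \sum_(j < n.+2) u (m.+1 + j) = a + K + c.
  by rewrite big_ord_recr /= K3 addSn.
have Ed : d n.+1 * (a - c) = a * c := d_u_sub m n.
have R1 : rise n.+1 = rise n * (n.+1%:R + (y - x)) by rewrite /rise big_ord_recr.
set s := w m.+1.
(* Since [1 - (n+1+y-x)/(m+n+2-x) = (m+1-y)/(m+n+2-x)], the factor [c] is [w] times the relative
   drop from [crem m.+1 n] to [crem m.+1 n.+1]. *)
have Ew : s * (1 - (n.+1%:R + (y - x)) * c) = c.
  have H1 := wK m; have H2 := uK (m + n.+1)%N; rewrite -/c in H2; rewrite -/s in H1.
  transitivity (s * (c * ((m + n.+1).+1%:R - x) - (n.+1%:R + (y - x)) * c)).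
    by rewrite H2.
  transitivity (c * (s * (m.+1%:R - y))); last by rewrite H1 mulr1.
  by rewrite -addSn natrD; ring.
split.
  rewrite /csum /crem P1 P2 P3 P4 R1.
  transitivity (rise n * P * (d n.+1 * (a - c))); first by ring.
  by rewrite Ed -{1}Ew; ring.
rewrite /csum /crem P1 P2 P3 P4 R1 K1 K2 K3 K4.
transitivity (rise n * P * (d n.+1 * (a - c)) * (K + a + c)); first by ring.
rewrite Ed.
transitivity (rise n * P * a * (s * (1 - (n.+1%:R + (y - x)) * c)) * (K + a)
  + rise n * P * a * c * (s * (1 - (n.+1%:R + (y - x)) * c))); first by rewrite Ew; ring.
have Es : rise n * P * a * c * s
  = rise n * P * a * (s * (1 - (n.+1%:R + (y - x)) * c)) * s by rewrite Ew.
transitivity (rise n * P * a * (s * (1 - (n.+1%:R + (y - x)) * c)) * (K + a)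
  + rise n * P * a * c * s - rise n * P * a * c * (s * ((n.+1%:R + (y - x)) * c))).
  by ring.
by rewrite Es; ring.
Qed.

Lemma sum_csum_step m n :
  \sum_(i < n) (csum m i - csum m.+1 i) = w m.+1 * (u m.+1 - crem m.+1 n).
Proof.
elim: n => [|n IH].
  by rewrite big_ord0 /crem /rise big_ord0 big_ord1 addn0; ring.
by rewrite big_ord_recr /= IH (csum_step m n).1; ring.
Qed.

Lemma sum_csum_harm_step m n :
  \sum_(i < n) (csum m i * harm m i.+1 - csum m.+1 i * harm m.+1 i.+1) =
  w m.+1 * u m.+1 ^+ 2 + w m.+1 ^+ 2 * u m.+1
  - crem m.+1 n * (w m.+1 * (\sum_(j < n.+1) u (m.+1 + j)) + w m.+1 ^+ 2).
Proof.
elim: n => [|n IH].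
  by rewrite big_ord0 /crem /rise big_ord0 !big_ord1 addn0; ring.
by rewrite big_ord_recr /= IH (csum_step m n).2; ring.
Qed.

(** Partial sums of [1/((m-x)(m-y))] plus [y] times their derivative along [d/dx + d/dy]. *)
Definition main_gf (n : nat) : A :=
  \sum_(m < n) (u m.+1 * w m.+1
     + y * (w m.+1 * u m.+1 ^+ 2 + w m.+1 ^+ 2 * u m.+1)).

(** The first sum is what is left after [n] shifts, the second collects the telescoping
    remainders. *)
Definition csum_err (n : nat) : A :=
  \sum_(i < n) csum n i * (1 + y * harm n i.+1)
  - \sum_(m < n) crem m.+1 n * w m.+1
      * (1 + y * (\sum_(j < n.+1) u (m.+1 + j) + w m.+1)).

Lemma sum_csum n :
  \sum_(i < n) csum 0 i * (1 + y * harm 0 i.+1) = main_gf n + csum_err n.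
Proof.
rewrite /csum_err /main_gf.
(* The number [M] of shifts is separated from the number [n] of terms, so that the induction runs on
   [M] alone. *)
suff E M : \sum_(i < n) csum 0 i * (1 + y * harm 0 i.+1)
    = \sum_(m < M) (u m.+1 * w m.+1
       + y * (w m.+1 * u m.+1 ^+ 2 + w m.+1 ^+ 2 * u m.+1))
    + (\sum_(i < n) csum M i * (1 + y * harm M i.+1)
      - \sum_(m < M) crem m.+1 n * w m.+1
        * (1 + y * (\sum_(j < n.+1) u (m.+1 + j) + w m.+1))) by exact: E.
elim: M => [|M IH]; first by rewrite !big_ord0; ring.
rewrite {}IH !(@big_ord_recr _ _ _ M) /=.
have -> : \sum_(i < n) csum M i * (1 + y * harm M i.+1) =
    \sum_(i < n) csum M.+1 i * (1 + y * harm M.+1 i.+1)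
    + (\sum_(i < n) (csum M i - csum M.+1 i) + y *
      \sum_(i < n) (csum M i * harm M i.+1 - csum M.+1 i * harm M.+1 i.+1)).
  rewrite mulr_sumr -!big_split /=; apply: eq_bigr => i _; ring.
by rewrite sum_csum_step sum_csum_harm_step; ring.
Qed.

(** The constant 1 left in each coefficient beside the part of [diff_gf]; [u - d] omits the exponent
    [s_1 = 1]. *)
Definition sum_gf (n : nat) : A :=
  \sum_(i < n) y * (u i.+1 - d i.+1) * chain_gf i.

Definition diff_err (n : nat) : A :=
  \sum_(i < n) d i.+1 * chain_top i.+1 * (harm 0 n - harm 0 (n - i.+1)).

Lemma sum_gfE n : sum_gf n = x * y * \sum_(i < n) csum 0 i.
Proof.
rewrite /sum_gf mulr_sumr; apply: eq_bigr => i _.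
rewrite -[RHS]mulrA csum0 /chain_top /=; have H1 := uK i; have H2 := dK i.
set a := u _ in H1 *; set c := d _ in H2 *.
have -> : a - c = x * (a * c).
  transitivity (a * (c * i.+1%:R) - c * (a * (i.+1%:R - x))).
    by rewrite H1 H2 !mulr1.
  by ring.
by ring.
Qed.

(** In [1 + y * harm] the 1 comes from [sum_gf] and the harmonic sum from [diff_gf]. *)
Lemma total_gfE n :
  diff_gf n + sum_gf n = x * y * (main_gf n + csum_err n - diff_err n).
Proof.
rewrite diff_gfE sum_gfE -sum_csum -mulrDr; congr (_ * _).
rewrite sum_u_chain_conv /diff_err -sumrB -big_split /=.
by apply: eq_bigr => i _; rewrite -csum0; ring.
Qed.
End FiniteIdentities.

(** * Error bounds *)

Section RealBounds.
Variable R : rcfType.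
Implicit Types (n : nat) (f : nat -> R).

(** Fourth roots replace logarithms: [n^(1/4)] dominates the harmonic sum and is still beaten by the
    decay [n^(-1/2)] in the error terms. *)
Definition root4 n : R := Num.sqrt (Num.sqrt n%:R).

Lemma root4K n : root4 n ^+ 4 = n%:R.
Proof. by rewrite (exprM _ 2 2) !sqr_sqrtr // sqrtr_ge0. Qed.

Lemma root4_ge1 n : 1 <= root4 n.+1.
Proof. by rewrite -(ler_pXn2r (ltn0Sn 3)) ?nnegrE ?sqrtr_ge0 // expr1n root4K ler1n. Qed.

Lemma sum_inv_le_root4 n : \sum_(j < n) (j.+1%:R : R)^-1 <= 4 * root4 n.
Proof.
elim: n => [|n IH]; first by rewrite big_ord0 mulr_ge0 ?sqrtr_ge0.
rewrite big_ord_recr /=; apply: le_trans (lerD IH (lexx _)) _.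
have := root4K n; have := root4K n.+1; have := root4_ge1 n.
have : 0 <= root4 n := sqrtr_ge0 _.
move: (root4 n) (root4 n.+1) => s t s0 t1 Et Es.
rewrite -Et.
have st : s <= t.
  by rewrite -(ler_pXn2r (ltn0Sn 3)) ?nnegrE ?(le_trans ler01 t1) // Es Et ler_nat.
have D : (t - s) * ((t + s) * (t ^+ 2 + s ^+ 2)) = 1.
  have : t ^+ 4 - s ^+ 4 = 1 by rewrite Et Es -natr1; ring.
  by move=> <-; ring.
have t0 : 0 < t by lra.
have t4 : 0 < t ^+ 4 by rewrite exprn_gt0.
(* This follows from [1 = t^4 - s^4 <= 4 t^3 (t - s)] and [t >= 1]. *)
suff : (t ^+ 4)^-1 <= 4 * (t - s) by lra.
rewrite -[_^-1]mul1r ler_pdivrMr // -{1}D -mulrA [4 * _]mulrCA.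
apply: ler_wpM2l; first by rewrite subr_ge0.
apply: (@le_trans _ _ ((t + t) * (t ^+ 2 + t ^+ 2))).
  by apply: ler_pM; rewrite ?addr_ge0 ?sqr_ge0 ?(ltW t0) // lerD2l // !expr2; apply: ler_pM.
rewrite (_ : (t + t) * _ = 4 * (t ^+ 3)); last by ring.
by apply: ler_wpM2l; rewrite // [t ^+ 4]exprS ler_peMl // exprn_ge0 // ltW.
Qed.

Lemma sum_inv_sqr_le2 n : \sum_(j < n) (j.+1%:R : R)^-1 ^+ 2 <= 2.
Proof.
(* The subtracted [2/(n+1)] makes the induction close: each step has slack [n/((n+1)^2 (n+2))]. *)
suff : \sum_(j < n) (j.+1%:R : R)^-1 ^+ 2 <= 2 - 2 * (n.+1%:R)^-1.
  by move=> H; apply: le_trans H _; rewrite lerBlDr lerDl mulr_ge0 ?invr_ge0.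
elim: n => [|n IH]; first by rewrite big_ord0 invr1; lra.
rewrite big_ord_recr /=; apply: le_trans (lerD IH (lexx _)) _.
have n0 : 0 <= n%:R :> R by [].
rewrite -subr_ge0 (_ : _ - _ = n%:R / (n.+1%:R ^+ 2 * n.+2%:R)).
  by rewrite divr_ge0 ?mulr_ge0.
rewrite -[n.+2]addn2 -[n.+1]addn1 !natrD.
by field; apply/andP; split; lra.
Qed.

(** The squared factors are dominated by ratios whose product telescopes to [g n]. *)
Lemma prod_le_sqrt n f g : g 0%N = 1 -> (forall j, 0 < g j) ->
  (forall j, 0 <= f j) -> (forall j, f j ^+ 2 <= g j.+1 / g j) ->
  \prod_(j < n) f j <= Num.sqrt (g n).
Proof.
move=> g00 g0 f0 f2; have p0 : 0 <= \prod_(j < n) f j by exact: prodr_ge0.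
rewrite -[leLHS]ger0_norm // -sqrtr_sqr ler_wsqrtr //.
elim: n {p0} => [|n IH]; first by rewrite big_ord0 expr1n g00.
rewrite big_ord_recr /= exprMn.
apply: (@le_trans _ _ (g n * (g n.+1 / g n))).
  by apply: ler_pM; rewrite ?sqr_ge0.
by rewrite mulrCA divff ?mulr1 ?gt_eqF.
Qed.
End RealBounds.

(** * Bounds in an abstract submultiplicative norm *)

Section Norm.
Variables (R : rcfType) (A : comPzRingType) (nrm : A -> R).
Hypothesis nrm_ge0 : forall a, 0 <= nrm a.
Hypothesis nrm0 : nrm 0 = 0.
Hypothesis nrm1 : nrm 1 <= 1.
Hypothesis nrmN : forall a, nrm (- a) = nrm a.
Hypothesis nrmD : forall a b, nrm (a + b) <= nrm a + nrm b.
Hypothesis nrmM : forall a b, nrm (a * b) <= nrm a * nrm b.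
Variables (x y : A) (d u w : nat -> A).
Hypothesis nrm_x : nrm x <= 8^-1.
Hypothesis nrm_y : nrm y <= 8^-1.
Hypothesis nrm_d : forall m, nrm (d m.+1) <= m.+1%:R^-1.
Hypothesis nrm_u : forall m, nrm (u m.+1) <= (m.+1%:R - 8^-1)^-1.
Hypothesis nrm_w : forall m, nrm (w m.+1) <= (m.+1%:R - 8^-1)^-1.

Lemma nrmB a b : nrm (a - b) <= nrm a + nrm b.
Proof. by rewrite -(nrmN b) nrmD. Qed.

Lemma nrm_le_sum I (s : seq I) (P : pred I) (F : I -> A) (G : I -> R) :
  (forall i, P i -> nrm (F i) <= G i) ->
  nrm (\sum_(i <- s | P i) F i) <= \sum_(i <- s | P i) G i.
Proof.
move=> FG; elim/big_rec2: _ => [|i a b Pi le_ab]; first by rewrite nrm0.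
exact: le_trans (nrmD _ _) (lerD (FG i Pi) le_ab).
Qed.

Lemma nrm_leM a b (s t : R) : nrm a <= s -> nrm b <= t -> nrm (a * b) <= s * t.
Proof. by move=> ha hb; apply: le_trans (nrmM _ _) _; apply: ler_pM. Qed.

Lemma nrm_le_prod I (s : seq I) (P : pred I) (F : I -> A) (G : I -> R) :
  (forall i, P i -> nrm (F i) <= G i) ->
  nrm (\prod_(i <- s | P i) F i) <= \prod_(i <- s | P i) G i.
Proof.
move=> FG; elim/big_rec2: _ => [|i a b Pi le_ab]; first exact: nrm1.
exact: nrm_leM (FG i Pi) le_ab.
Qed.

Lemma nrm_nat n : nrm n%:R <= n%:R.
Proof.
elim: n => [|n IH]; first by rewrite nrm0.
by rewrite -!natr1; apply: le_trans (nrmD _ _) (lerD IH nrm1).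
Qed.

Lemma ge1S m : 1 <= m.+1%:R :> R. Proof. by rewrite ler1n. Qed.

Lemma inv_le2 m : (m.+1%:R - 8^-1)^-1 <= 2 * m.+1%:R^-1 :> R.
Proof.
have := ge1S m; move: (m.+1%:R : R) => z z1.
by rewrite -invf_div lef_pV2 ?posrE; lra.
Qed.

Lemma nrm_u2 m : nrm (u m.+1) <= 2 * m.+1%:R^-1.
Proof. exact: le_trans (nrm_u m) (inv_le2 m). Qed.

Lemma nrm_w2 m : nrm (w m.+1) <= 2 * m.+1%:R^-1.
Proof. exact: le_trans (nrm_w m) (inv_le2 m). Qed.

(** Each factor is at most [z/(z - 1/8)] with [z = j+1], whose square stays below [(z+1)/z]. *)
Lemma nrm_chain_gf n : nrm (chain_gf y u n) <= Num.sqrt n.+1%:R.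
Proof.
pose f j : R := 1 + 8^-1 * (j.+1%:R - 8^-1)^-1.
apply: (@le_trans _ _ (\prod_(j < n) f j)).
  apply: nrm_le_prod => j _; apply: le_trans (nrmD _ _) (lerD nrm1 _).
  exact: nrm_leM.
have fE j : f j = j.+1%:R / (j.+1%:R - 8^-1).
  by rewrite /f; have := ge1S j; move: (j.+1%:R : R) => z z1; field; lra.
apply: (prod_le_sqrt n (g := fun n => n.+1%:R)) => // j; rewrite fE; have := ge1S j.
  by move=> ?; rewrite divr_ge0 // subr_ge0; lra.
rewrite -[j.+2]addn1 natrD; move: (j.+1%:R : R) => z z1.
rewrite expr_div_n ler_pdivlMr; last by lra.
rewrite mulrAC ler_pdivrMr; last by rewrite exprn_gt0 //; lra.
rewrite -subr_ge0 (_ : _ - _ = 3 / 4 * (z * z) - 15 / 64 * z + 64^-1); last by field.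
by nra.
Qed.

Lemma nrm_chain_top i : nrm (chain_top y u i.+1) <= Num.sqrt i.+1%:R / i.+1%:R.
Proof.
rewrite mulrC; apply: nrm_leM (nrm_chain_gf i).
apply: le_trans (nrm_leM nrm_y (nrm_u2 i)) _.
have : 0 <= (i.+1%:R : R)^-1 by rewrite invr_ge0.
by move: (i.+1%:R^-1) => z; lra.
Qed.

Lemma nrm_harm_sub n i : (i < n)%N ->
  nrm (harm u 0 n - harm u 0 (n - i.+1)) <= i.+1%:R * (2 / (n - i)%:R).
Proof.
move=> lt_in.
have -> : harm u 0 n - harm u 0 (n - i.+1) = \sum_(j < i.+1) u (n - i.+1 + j).+1.
  rewrite /harm -[in X in X - _ = _](subnK lt_in) big_split_ord /=.
  rewrite [LHS]addrAC subrr add0r.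
  by apply: eq_bigr => j _; rewrite add0n.
rewrite mulr_natl -[X in _ *+ X]card_ord -sumr_const.
apply: nrm_le_sum => j _; apply: le_trans (nrm_u2 _) _.
rewrite ler_pM2l // lef_pV2 ?posrE ?ltr0n ?ler_nat //; lia.
Qed.

(** With [N = n+1], each term is at most [2 sqrt N / ((i+1)(N-i))]. As [(i+1) + (N-i) = N+1],
    partial fractions give two harmonic sums divided by [N+1], in total of order
    [N^(1/2 + 1/4 - 1)]. *)
Lemma nrm_diff_err n : nrm (diff_err y d u n.+1) <= 16 / root4 R n.+1.
Proof.
set N := n.+1.
apply: (@le_trans _ _ (\sum_(i < N) 2 * (Num.sqrt N%:R / N.+1%:R) *
     (i.+1%:R^-1 + (N - i)%:R^-1))).
  apply: nrm_le_sum => i _; have lt_in := ltn_ord i.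
  apply: le_trans (nrm_leM (nrm_leM (nrm_d i) (nrm_chain_top i)) (nrm_harm_sub lt_in)) _.
  have -> : N.+1%:R = i.+1%:R + (N - i)%:R :> R.
    by rewrite -natrD; congr (_%:R); lia.
  have sq : Num.sqrt i.+1%:R <= Num.sqrt N%:R :> R by rewrite ler_wsqrtr ?ler_nat.
  have := ge1S i; have : 1 <= (N - i)%:R :> R by rewrite ler1n subn_gt0.
  move: sq (sqrtr_ge0 (i.+1%:R : R)).
  move: (Num.sqrt (i.+1%:R : R)) (Num.sqrt (N%:R : R)) => s t.
  move: (i.+1%:R : R) ((N - i)%:R : R) => b a st s0 a1 b1.
  have -> : b^-1 * (s / b) * (b * (2 / a)) = 2 * s / (b * a).
    by field; apply/andP; split; lra.
  have -> : 2 * (t / (b + a)) * (b^-1 + a^-1) = 2 * t / (b * a).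
    by field; rewrite !gt_eqF //; lra.
  by rewrite ler_pM2r ?ler_pM2l // invr_gt0 mulr_gt0; lra.
rewrite -mulr_sumr big_split /= [X in _ + X](_ : _ = \sum_(i < N) i.+1%:R^-1); last first.
  rewrite (reindex_inj rev_ord_inj) /=; apply: eq_bigr => i _.
  by rewrite subKn.
have := sum_inv_le_root4 R N; have := root4K R N; have := root4_ge1 R n.
rewrite -/N -[N.+1]addn1 natrD.
have -> : Num.sqrt N%:R = root4 R N ^+ 2 by rewrite sqr_sqrtr ?sqrtr_ge0.
move: (root4 R N) (\sum_(i < N) _) => q h q1 <- hq.
have q0 : 0 < q by lra.
have q40 : 0 < q ^+ 4 by rewrite exprn_gt0.
apply: (@le_trans _ _ (2 * (q ^+ 2 / q ^+ 4) * (4 * q + 4 * q))); last first.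
  rewrite le_eqVlt; apply/orP; left; apply/eqP; field; lra.
apply: (@le_trans _ _ (2 * (q ^+ 2 / (q ^+ 4 + 1)) * (4 * q + 4 * q))).
  apply: ler_wpM2l; last by lra.
  by rewrite mulr_ge0 ?divr_ge0 ?exprn_ge0 ?addr_ge0 ?exprn_ge0 //; lra.
apply: ler_wpM2r; first by lra.
apply: ler_wpM2l => //; apply: ler_wpM2l; first by rewrite exprn_ge0 ?ltW.
by rewrite lef_pV2 ?posrE; lra.
Qed.

Lemma nrm_rise n : nrm (rise x y n) <= \prod_(j < n) (j.+1%:R + 4^-1).
Proof.
apply: nrm_le_prod => j _; apply: le_trans (nrmD _ _) (lerD (nrm_nat _) _).
apply: le_trans (nrmB _ _) (le_trans (lerD nrm_y nrm_x) _).
by lra.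
Qed.

(** Pairing [j+1+1/4] from [rise] with [1/(n+1+j+1-1/8)] gives factors at most 1; the unpaired last
    [u] supplies [1/(n+1)]. *)
Lemma nrm_csum n i : nrm (csum x y d u n.+1 i) <= n.+1%:R^-1 * i.+1%:R^-1.
Proof.
rewrite /csum -mulrA [leRHS]mulrC; apply: nrm_leM => //.
pose f j : R := (n.+1%:R + j.+1%:R - 8^-1)^-1.
apply: (@le_trans _ _ ((\prod_(j < i) (j.+1%:R + 4^-1)) * \prod_(j < i.+1) f j)).
  apply: nrm_leM; first exact: nrm_rise.
  by apply: nrm_le_prod => j _; rewrite /f -natrD addSn; apply: nrm_u.
have n1 := ge1S n; rewrite big_ord_recr /= mulrA -big_split /=.
rewrite -[leRHS]mul1r; apply: ler_pM.
- apply: prodr_ge0 => j _; have := ge1S j => j1.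
  by apply: mulr_ge0; rewrite /f ?invr_ge0; lra.
- by rewrite /f invr_ge0; have := ge1S i; lra.
- apply: prodr_ile1 => j _; have := ge1S j; rewrite /f.
  move: (n.+1%:R : R) n1 (j.+1%:R : R) => b b1 a a1.
  by rewrite divr_ge0 ?ler_pdivrMr //; lra.
- have := ge1S i; rewrite /f; move: (n.+1%:R : R) n1 (i.+1%:R : R) => b b1 a a1.
  by rewrite lef_pV2 ?posrE; lra.
Qed.

Lemma nrm_csum_err1 n :
  nrm (\sum_(i < n.+1) csum x y d u n.+1 i * (1 + y * harm u n.+1 i.+1))
    <= 8 / root4 R n.+1.
Proof.
apply: (@le_trans _ _ (\sum_(i < n.+1) n.+1%:R^-1 * i.+1%:R^-1 * 2)).
  apply: nrm_le_sum => i _; apply: nrm_leM (nrm_csum n i) _.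
  apply: le_trans (nrmD _ _) (lerD nrm1 _).
  apply: (@le_trans _ _ (8^-1 * (i.+1%:R * (2 * n.+1%:R^-1)))).
    apply: nrm_leM => //; rewrite mulr_natl -[X in _ *+ X]card_ord -sumr_const.
    apply: nrm_le_sum => j _; rewrite addSn; apply: le_trans (nrm_u2 _) _.
    by rewrite ler_pM2l // lef_pV2 ?posrE ?ltr0n ?ler_nat //; lia.
  have : i.+1%:R / n.+1%:R <= 1 :> R by rewrite ler_pdivrMr ?mul1r ?ler_nat.
  by rewrite [i.+1%:R * (2 * _)]mulrCA; move: (_ / _) => z; lra.
rewrite -mulr_suml -mulr_sumr.
have := sum_inv_le_root4 R n.+1; have := root4K R n.+1; have := root4_ge1 R n.
move: (root4 R n.+1) (\sum_(i < n.+1) _) => q h q1 <- hq.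
have q0 : 0 < q by lra.
have q40 : 0 < q ^+ 4 by rewrite exprn_gt0.
apply: (@le_trans _ _ ((q ^+ 4)^-1 * (4 * q) * 2)).
  by rewrite ler_pM2r // ler_pM2l // invr_gt0.
have -> : (q ^+ 4)^-1 * (4 * q) * 2 = 8 / q ^+ 3 by field; lra.
rewrite ler_pM2l // lef_pV2 ?posrE ?exprn_gt0 //.
by rewrite -[leLHS]mulr1 exprS ler_pM2l // exprn_ege1.
Qed.

(** With the leading [u m.+1] set aside, each remaining factor is at most [(z+1/4)/(z+7/8)],
    [z = j+1]. The gap 5/8 exceeds 1/2, so the square is at most [z/(z+1)]; here the bound 1/8 on
    [x] and [y] is small enough. *)
Lemma nrm_crem m n :
  nrm (crem x y u m.+1 n) <= 2 * m.+1%:R^-1 / Num.sqrt n.+1%:R.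
Proof.
pose f j : R := (j.+1%:R + 4^-1) / (j.+2%:R - 8^-1).
have f0 j : 0 < f j.
  by have := ge1S j; have := ge1S j.+1 => ? ?; apply: divr_gt0; lra.
apply: (@le_trans _ _ (2 * m.+1%:R^-1 * \prod_(j < n) f j)).
  rewrite /crem big_ord_recl addn0 mulrCA; apply: nrm_leM (nrm_u2 m) _.
  rewrite [leRHS]big_split /=; apply: nrm_leM; first exact: nrm_rise.
  apply: nrm_le_prod => j _; rewrite addSn.
  apply: le_trans (nrm_u _) _; rewrite /bump /=.
  have := ge1S j.+1; have : j.+2%:R <= (m + (1 + j)).+1%:R :> R by rewrite ler_nat; lia.
  by move=> H ?; rewrite lef_pV2 ?posrE; lra.
rewrite ler_pM2l ?mulr_gt0 ?invr_gt0 // -sqrtrV //.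
apply: (prod_le_sqrt n (g := fun n => n.+1%:R^-1)) => [|j|j|j].
- by rewrite invr1.
- by rewrite invr_gt0.
- exact: ltW.
rewrite invrK mulrC /f -[j.+2]addn1 natrD.
have := ge1S j; move: (j.+1%:R : R) => z z1.
rewrite expr_div_n ler_pdivlMr; last by lra.
rewrite mulrAC ler_pdivrMr; last by rewrite exprn_gt0 //; lra.
rewrite -subr_ge0 (_ : _ - _ = 4^-1 * (z * z) + 13 / 64 * z - 16^-1); last by field.
by nra.
Qed.

(** [crem] and [w] each contribute a factor [1/(m+1)], so the sum over [m] stays bounded, and the
    [n^(-1/2)] of [crem] outweighs the [n^(1/4)] of the harmonic sum. *)
Lemma nrm_csum_err2 n :
  nrm (\sum_(m < n.+1) crem x y u m.+1 n.+1 * w m.+1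
      * (1 + y * (\sum_(j < n.+2) u (m.+1 + j) + w m.+1)))
    <= 56 / root4 R n.+1.
Proof.
have := sum_inv_le_root4 R n.+1; have := root4K R n.+1; have := root4_ge1 R n.
have Eq : Num.sqrt n.+1%:R = root4 R n.+1 ^+ 2 by rewrite sqr_sqrtr ?sqrtr_ge0.
move: (root4 R n.+1) Eq => q Eq q1 _ hq; have q0 : 0 < q by lra.
apply: (@le_trans _ _ (\sum_(m < n.+1) (m.+1%:R^-1) ^+ 2 * (28 / q))).
  apply: nrm_le_sum => m _.
  apply: (@le_trans _ _ (2 * m.+1%:R^-1 / q ^+ 2 * (2 * m.+1%:R^-1) * (7 * q))).
    apply: nrm_leM; last first.
      apply: le_trans (nrmD _ _) _.
      apply: (@le_trans _ _ (1 + 8^-1 * (2 * (4 * q + 1) + 2))); last by lra.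
      apply: lerD nrm1 _; apply: nrm_leM => //.
      apply: le_trans (nrmD _ _) _; apply: lerD; last first.
        apply: le_trans (nrm_w2 _) _; rewrite -[leRHS]mulr1 ler_pM2l //.
        by rewrite invf_le1 ?ler1n.
      apply: (@le_trans _ _ (2 * \sum_(j < n.+2) j.+1%:R^-1)).
        rewrite mulr_sumr; apply: nrm_le_sum => j _; rewrite addSn.
        apply: le_trans (nrm_u2 _) _.
        by rewrite ler_pM2l // lef_pV2 ?posrE ?ltr0n ?ler_nat // ltnS leq_addl.
      rewrite ler_pM2l // big_ord_recr /=; apply: lerD => //.
      by rewrite invf_le1 ?ler1n.
    apply: nrm_leM (nrm_w2 _); apply: le_trans (nrm_crem _ _) _.
    rewrite -Eq ler_pM2l ?mulr_gt0 ?invr_gt0 //.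
    by rewrite lef_pV2 ?posrE ?sqrtr_gt0 ?ltr0n // ler_wsqrtr ?ler_nat.
  rewrite le_eqVlt; apply/orP; left; apply/eqP.
  have := ge1S m; move: (m.+1%:R : R) => z z1.
  by field; apply/andP; split; lra.
rewrite -mulr_suml; apply: le_trans (ler_wpM2r _ (sum_inv_sqr_le2 R n.+1)) _.
  by rewrite divr_ge0 // ltW.
by rewrite mulrA -natrM.
Qed.

Lemma nrm_total_err n :
  nrm (csum_err x y d u w n.+1 - diff_err y d u n.+1) <= 80 / root4 R n.+1.
Proof.
apply: le_trans (nrmB _ _) _; apply: le_trans (lerD (nrmB _ _) (lexx _)) _.
apply: le_trans
  (lerD (lerD (nrm_csum_err1 n) (nrm_csum_err2 n)) (nrm_diff_err n)) _.
by rewrite -!mulrDl -!natrD.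
Qed.
End Norm.

(** * Formal power series *)

Lemma sum_triangle (V : nmodType) n (F : nat -> nat -> V) :
  \sum_(i < n) \sum_(j < i.+1) F j (i - j)%N = \sum_(j < n) \sum_(i < n - j) F j i.
Proof.
elim: n => [|n IH]; first by rewrite !big_ord0.
rewrite big_ord_recr /= IH [RHS]big_ord_recr /= subSnn big_ord1.
rewrite [\sum_(j < n.+1) _]big_ord_recr /= subnn addrA -big_split /=; congr (_ + _).
by apply: eq_bigr => j _; rewrite subSn ?big_ord_recr // ltnW.
Qed.

(** A record rather than a bare function type, so that products are convolutions and not
    pointwise. *)
Record fps (A : Type) := Fps { scoef :> nat -> A }.

Lemma fpsP (A : Type) (f g : fps A) : (forall i, f i = g i) -> f = g.
Proof. by case: f g => [f] [g] /= fg; congr Fps; apply/funext. Qed.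

HB.instance Definition _ (A : Type) := gen_eqMixin (fps A).
HB.instance Definition _ (A : Type) := gen_choiceMixin (fps A).

Section FpsZmod.
Variable A : zmodType.
Implicit Types f g h : fps A.
Definition fps0 : fps A := Fps (fun=> 0).
Definition fps_opp f : fps A := Fps (fun i => - f i).
Definition fps_add f g : fps A := Fps (fun i => f i + g i).
Lemma fps_addA : associative fps_add.
Proof. by move=> f g h; apply: fpsP => i; exact: addrA. Qed.
Lemma fps_addC : commutative fps_add.
Proof. by move=> f g; apply: fpsP => i; exact: addrC. Qed.
Lemma fps_add0 : left_id fps0 fps_add.
Proof. by move=> f; apply: fpsP => i; exact: add0r. Qed.
Lemma fps_addN : left_inverse fps0 fps_opp fps_add.
Proof. by move=> f; apply: fpsP => i; exact: addNr. Qed.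
HB.instance Definition _ := GRing.isZmodule.Build (fps A)
  fps_addA fps_addC fps_add0 fps_addN.

Lemma scoef0 i : (0 : fps A) i = 0. Proof. by []. Qed.
Lemma scoefN f i : (- f) i = - f i. Proof. by []. Qed.
Lemma scoefD f g i : (f + g) i = f i + g i. Proof. by []. Qed.
Lemma scoefB f g i : (f - g) i = f i - g i. Proof. by []. Qed.
Lemma scoef_sum I (s : seq I) (P : pred I) (F : I -> fps A) i :
  (\sum_(j <- s | P j) F j) i = \sum_(j <- s | P j) F j i.
Proof. by elim/big_rec2: _ => // j a f _ <-. Qed.
End FpsZmod.

Section FpsRing.
Variable A : comPzRingType.
Implicit Types f g h : fps A.
Definition fpsC (c : A) : fps A := Fps (fun i => c *+ (i == 0%N)).
Definition fps_mul f g : fps A :=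
  Fps (fun n => \sum_(i < n.+1) f i * g (n - i)%N).
Lemma fps_mulA : associative fps_mul.
Proof.
move=> f g h; apply: fpsP => n /=.
transitivity (\sum_(j < n.+1) \sum_(i < n.+1 - j) f j * g i * h (n - j - i)%N).
  apply: eq_bigr => j _; rewrite mulr_sumr subSn ?leq_ord //.
  by apply: eq_bigr => i _; rewrite mulrA.
rewrite -(sum_triangle n.+1 (fun j i => f j * g i * h (n - j - i)%N)).
apply: eq_bigr => i _; rewrite mulr_suml; apply: eq_bigr => j _.
by rewrite -subnDA subnKC ?leq_ord.
Qed.
Lemma fps_mulC : commutative fps_mul.
Proof.
move=> f g; apply: fpsP => n /=; rewrite (reindex_inj rev_ord_inj) /=.
by apply: eq_bigr => i _; rewrite subSS subKn ?leq_ord // mulrC.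
Qed.
Lemma fps_mul1 : left_id (fpsC 1) fps_mul.
Proof.
move=> f; apply: fpsP => n /=.
rewrite big_ord_recl /= subn0 mul1r big1 ?addr0 // => i _.
by rewrite mul0r.
Qed.
Lemma fps_mulDl : left_distributive fps_mul +%R.
Proof.
move=> f g h; apply: fpsP => n /=; rewrite -big_split /=.
by apply: eq_bigr => i _; rewrite mulrDl.
Qed.
HB.instance Definition _ := GRing.Zmodule_isComPzRing.Build (fps A)
  fps_mulA fps_mulC fps_mul1 fps_mulDl.

Lemma scoefM f g n : (f * g) n = \sum_(i < n.+1) f i * g (n - i)%N.
Proof. by []. Qed.
Lemma scoef1 n : (1 : fps A) n = (n == 0%N)%:R. Proof. by []. Qed.
Lemma scoef_nat m n : (m%:R : fps A) n = m%:R *+ (n == 0%N).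
Proof.
elim: m => [|m IH]; first by rewrite scoef0 mul0rn.
by rewrite -!natr1 scoefD IH scoef1 mulrnDl.
Qed.

Definition fpsX : fps A := Fps (fun i => (i == 1%N)%:R).

Lemma scoefCM c f n : (fpsC c * f) n = c * f n.
Proof.
rewrite scoefM big_ord_recl /= subn0 mulr1n big1 ?addr0 // => i _.
by rewrite mul0r.
Qed.

Lemma scoefXM0 f : (fpsX * f) 0%N = 0.
Proof. by rewrite scoefM big_ord1 /= mul0r. Qed.

Lemma scoefXMS f n : (fpsX * f) n.+1 = f n.
Proof.
rewrite scoefM 2!big_ord_recl /= mul0r mul1r add0r subSS subn0 big1 ?addr0 //.
by move=> i _; rewrite mul0r.
Qed.

Lemma fpsCM (a b : A) : fpsC (a * b) = fpsC a * fpsC b.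
Proof. by apply: fpsP => i; rewrite scoefCM /= mulrnAr. Qed.
Lemma fpsCD (a b : A) : fpsC (a + b) = fpsC a + fpsC b.
Proof. by apply: fpsP => i; rewrite scoefD /= mulrnDl. Qed.
Lemma fpsCB (a b : A) : fpsC (a - b) = fpsC a - fpsC b.
Proof. by apply: fpsP => i; rewrite scoefB /= mulrnBl. Qed.
Lemma fpsC_nat n : fpsC n%:R = n%:R.
Proof. by apply: fpsP => i; rewrite scoef_nat. Qed.
Lemma fpsCX (a : A) n : fpsC a ^+ n = fpsC (a ^+ n).
Proof. by elim: n => [|n IH] //; rewrite !exprS IH fpsCM. Qed.

(** The expansion of [1/(z - c X)] for [a = 1/z]. *)
Definition geo (a c : A) : fps A := Fps (fun i => c ^+ i * a ^+ i.+1).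

Lemma geoK (a c z : A) : a * z = 1 ->
  geo a c * (fpsC z - fpsC c * fpsX) = 1.
Proof.
move=> az; apply: fpsP => n; rewrite mulrC mulrBl scoefB -mulrA !scoefCM scoef1.
case: n => [|n]; first by rewrite scoefXM0 mulr0 subr0 /= mul1r mulrC az.
by rewrite scoefXMS /= exprS [a ^+ n.+2]exprS -[X in _ - X](mul1r) -az; ring.
Qed.

Lemma geo_sqr (a : A) n : (geo a 1 ^+ 2) n = n.+1%:R * a ^+ n.+2.
Proof.
rewrite expr2 scoefM (eq_bigr (fun=> a ^+ n.+2)) ?sumr_const ?card_ord ?mulr_natl //.
move=> i _; rewrite /= !expr1n !mul1r -exprD; congr (_ ^+ _); have := ltn_ord i; lia.
Qed.
End FpsRing.
Arguments fpsX {A}.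

Record is_norm (R : numDomainType) (A : pzRingType) (nrm : A -> R) : Prop := IsNorm {
  norm_ge0 : forall a, 0 <= nrm a;
  norm_0 : nrm 0 = 0;
  norm_1 : nrm 1 <= 1;
  norm_N : forall a, nrm (- a) = nrm a;
  norm_D : forall a b, nrm (a + b) <= nrm a + nrm b;
  norm_M : forall a b, nrm (a * b) <= nrm a * nrm b }.

(** * Weighted norms of truncated power series *)

Section FpsNorm.
Variables (R : realFieldType) (A : comPzRingType) (nrm : A -> R) (r : R) (L : nat).
Hypotheses (nrmP : is_norm nrm) (r0 : 0 <= r) (r1 : r < 1) (L0 : (0 < L)%N).

Definition snorm (f : fps A) : R := \sum_(i < L) nrm (f i) * r ^+ i.

Lemma snormC c : snorm (fpsC c) = nrm c.
Proof.
rewrite /snorm -(prednK L0) big_ord_recl /= mulr1 big1 ?addr0 // => i _.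
by rewrite (norm_0 nrmP) mul0r.
Qed.

(** For submultiplicativity: coefficients of [f * g] below [L] involve only pairs of degrees with
    sum below [L], a part of the [L] by [L] square covered by the product of the norms. *)
Lemma snormP : is_norm snorm.
Proof.
have rX i : 0 <= r ^+ i by exact: exprn_ge0.
split.
- by move=> f; apply: sumr_ge0 => i _; rewrite mulr_ge0 ?(norm_ge0 nrmP).
- by rewrite /snorm big1 // => i _; rewrite (norm_0 nrmP) mul0r.
- by rewrite [1]/(fpsC 1) snormC (norm_1 nrmP).
- by move=> f; apply: eq_bigr => i _; rewrite scoefN (norm_N nrmP).
- move=> f g; rewrite /snorm -big_split /=; apply: ler_sum => i _.
  by rewrite -mulrDl ler_wpM2r // (norm_D nrmP).
move=> f g; pose F j i := nrm (f j) * r ^+ j * (nrm (g i) * r ^+ i).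
have F0 j i : 0 <= F j i by rewrite !mulr_ge0 ?(norm_ge0 nrmP).
apply: (@le_trans _ _ (\sum_(i < L) \sum_(j < i.+1) F j (i - j)%N)).
  apply: ler_sum => i _; rewrite scoefM.
  apply: (@le_trans _ _ (\sum_(j < i.+1) nrm (f j * g (i - j)%N) * r ^+ i)).
    rewrite -mulr_suml ler_wpM2r //.
    elim/big_rec2: _ => [|j a b _ ab]; first by rewrite (norm_0 nrmP).
    by apply: le_trans (norm_D nrmP _ _) _; rewrite lerD2l.
  apply: ler_sum => j _; rewrite /F mulrACA -exprD subnKC ?leq_ord //.
  by rewrite ler_wpM2r // (norm_M nrmP).
rewrite sum_triangle /snorm mulr_suml; apply: ler_sum => j _.
rewrite mulr_sumr (big_ord_widen L (fun i => F j i) (leq_subr _ _)) big_mkcond /=.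
by apply: ler_sum => i _; case: ifP => _; [exact: lexx | exact: F0].
Qed.

Lemma snormX_le : snorm (@fpsX A) <= r.
Proof.
rewrite /snorm -(prednK L0) big_ord_recl /= (norm_0 nrmP) mul0r add0r.
case: L.-1 => [|l]; first by rewrite big_ord0.
rewrite big_ord_recl /= big1 => [|i _]; last by rewrite (norm_0 nrmP) mul0r.
by rewrite addr0 /bump /= addn0 expr1 ler_piMl // (norm_1 nrmP).
Qed.

Lemma sum_geo_le m : \sum_(i < L) (m.+1%:R : R)^-1 ^+ i.+1 * r ^+ i <= (m.+1%:R - r)^-1.
Proof.
have m1 : 1 <= m.+1%:R :> R by rewrite ler1n.
rewrite -[leRHS]mul1r ler_pdivlMr ?subr_gt0; last exact: lt_le_trans r1 m1.
suff -> : (\sum_(i < L) (m.+1%:R : R)^-1 ^+ i.+1 * r ^+ i) * (m.+1%:R - r) =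
    1 - (m.+1%:R^-1 * r) ^+ L.
  by rewrite gerBl exprn_ge0 // mulr_ge0 ?invr_ge0.
move: (m.+1%:R : R) m1 => z z1.
elim: L => [|l IH]; first by rewrite big_ord0 mul0r expr0 subrr.
rewrite big_ord_recr /= mulrDl IH !exprMn [z^-1 ^+ l.+1]exprS [r ^+ l.+1]exprS.
by field; lra.
Qed.

Lemma snorm_geo a m : (forall i, nrm (a ^+ i.+1) <= m.+1%:R^-1 ^+ i.+1) ->
  snorm (geo a 1) <= (m.+1%:R - r)^-1.
Proof.
move=> Ha; apply: le_trans (sum_geo_le m); apply: ler_sum => i _ /=.
by rewrite expr1n mul1r ler_wpM2r // exprn_ge0.
Qed.

Lemma scoef_le_snorm (f : fps A) i : (i < L)%N -> nrm (f i) * r ^+ i <= snorm f.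
Proof.
move=> iL; rewrite /snorm (bigD1 (Ordinal iL)) //= lerDl.
by apply: sumr_ge0 => j _; rewrite mulr_ge0 ?(norm_ge0 nrmP) ?exprn_ge0.
Qed.
End FpsNorm.

(** * Compositions and truncated multiple zeta values *)

(** Compositions of [n] into [k] positive parts, listed by first part to allow recursion on the
    depth. *)
Fixpoint comps (k n : nat) : seq (seq nat) :=
  if k is k'.+1 then
    flatten [seq [seq a.+1 :: s | s <- comps k' (n - a.+1)] | a <- iota 0 n]
  else if n == 0%N then [:: [::]] else [::].

Lemma big_comps (V : nmodType) k n (F : seq nat -> V) :
  \sum_(s <- comps k.+1 n) F s =
  \sum_(a < n) \sum_(s <- comps k (n - a.+1)) F (a.+1 :: s).
Proof.
rewrite /= big_flatten big_map -{1}[n]subn0 -/(index_iota 0 n) big_mkord.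
by apply: eq_bigr => a _; rewrite big_map.
Qed.

Lemma comps_small k n : (n < k)%N -> comps k n = [::].
Proof.
elim: k n => // k IH n nk; have [->//|n0] := posnP n; rewrite /=.
elim: (iota 0 n) => //= a l ->; rewrite cats0 IH //; lia.
Qed.

Lemma size_comps k n s : s \in comps k n -> size s = k.
Proof.
elim: k n s => [|k IH] n s /=; first by case: eqP => // _; rewrite inE => /eqP ->.
by move=> /flatten_mapP[a _ /mapP[s' /IH <- ->]].
Qed.

Lemma comps_pos k n s : s \in comps k n -> all (leq 1) s.
Proof.
elim: k n s => [|k IH] n s /=; first by case: eqP => // _; rewrite inE => /eqP ->.
by move=> /flatten_mapP[a _ /mapP[s' /IH Hs' ->]].
Qed.

(** Splitting a tuple into head and tail matches the recursion of [comps]; entries of a tuple with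
    sum [n] stay below [M]. *)
Lemma big_tuple_comps (V : nmodType) k n M (F : seq nat -> V) : (n < M)%N ->
  \sum_(t : k.-tuple 'I_M | all (fun x : 'I_M => (0 < x)%N) t
      && (sumn (map val t) == n)) F (map val t)
  = \sum_(s <- comps k n) F s.
Proof.
elim: k n F => [|k IH] n F nM.
  rewrite /=; case: eqP => [->|n0].
    by rewrite big_seq1 (big_pred1 [tuple]) // => t; rewrite (tuple0 t);
      apply/esym; exact: eqxx.
  by rewrite big_nil big1 // => t; rewrite tuple0 /= => /eqP /esym.
rewrite big_comps.
pose h (p : 'I_M * k.-tuple 'I_M) : k.+1.-tuple 'I_M := [tuple of p.1 :: p.2].
pose h' (t : k.+1.-tuple 'I_M) := (thead t, [tuple of behead t]).
have hK : cancel h h'.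
  by move=> [a t]; rewrite /h' theadE; congr (_, _); apply: val_inj.
have h'K : cancel h' h by move=> t; rewrite [RHS]tuple_eta.
rewrite (reindex h); last by exists h' => ? _; rewrite ?hK ?h'K.
rewrite /= (eq_bigl (fun p : 'I_M * k.-tuple 'I_M => (0 < p.1)%N &&
   (all (fun x : 'I_M => (0 < x)%N) p.2 && ((p.1 + sumn (map val p.2))%N == n)))); last first.
  by move=> p; rewrite /= andbA.
rewrite -(pair_big_dep (fun a : 'I_M => (0 < a)%N)
  (fun (a : 'I_M) (t : k.-tuple 'I_M) => all (fun x : 'I_M => (0 < x)%N) t &&
     ((a + sumn (map val t))%N == n)) (fun a t => F (val a :: map val t))) /=.
transitivity (\sum_(a < M) if (0 < a <= n)%N then
    \sum_(s <- comps k (n - a)) F (val a :: s) else 0).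
  rewrite big_mkcond /=; apply: eq_bigr => a _; case: posnP => //= a0.
  case: leqP => an.
    rewrite -(IH (n - a)%N (fun s => F (val a :: s))); last by lia.
    by apply: eq_bigl => t; rewrite -[in RHS](eqn_add2l a) subnKC.
  rewrite big1 // => t /andP[_ /eqP E].
  by move: an; rewrite -E ltnNge leq_addr.
pose G a := if (0 < a <= n)%N then \sum_(s <- comps k (n - a)) F (a :: s) else 0.
transitivity (\sum_(a < n.+1) G a).
  rewrite (big_ord_widen M G nM) [RHS]big_mkcond; apply: eq_bigr => a _ /=.
  by rewrite /G; case: (ltnP a n.+1) => // an; rewrite ifF //; lia.
rewrite big_ord_recl add0r; apply: eq_bigr => a _.
by rewrite /G /= ifT // /bump /= add1n ltn_ord.
Qed.

(** * Weights of compositions and their generating series *)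

Section Weights.
Variable R : realType.

(* One plus the factor of [2^(s_1-1) - 1] in [coef], as a function of
   [s_2, ..., s_k]. *)
Fixpoint tail_weight (s : seq nat) : R :=
  if s is a :: s' then
    if s' is [::] then 2 else 1 + 2 ^+ a.-1 * tail_weight s'
  else 0.

Lemma tail_weightE s : (0 < size s)%N -> all (leq 1) s ->
  tail_weight s = 1 + \sum_(1 <= i < size s) 2 ^+ (psum s i - i)
                  + 2 ^+ (psum s (size s).-1 - (size s).-1).
Proof.
have psum0 r : psum r 0 = 0%N by rewrite /psum big_geq.
have psumS a r i : psum (a :: r) i.+1 = (a + psum r i)%N.
  by rewrite /psum big_nat_recl.
(* Parts are at least 1, so the natural-number subtractions [psum s i - i] are exact. *)
have psum_ge r i : all (leq 1) r -> (i <= size r)%N -> (i <= psum r i)%N.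
  elim: r i => [|a r IH] [|i] //= /andP[a0 r0] ir; rewrite psumS.
  by have := IH i r0 ir; lia.
elim: s => // a [_ _ _|b s IH _ /andP[a0 s0]].
  by rewrite /= big_geq // psum0 addr0.
have E i : (i <= size (b :: s))%N ->
    2 ^+ (psum (a :: b :: s) i.+1 - i.+1) = 2 ^+ a.-1 * 2 ^+ (psum (b :: s) i - i) :> R.
  move=> /(psum_ge (b :: s) i s0); rewrite psumS -exprD => H.
  by congr (_ ^+ _); lia.
have ES : \sum_(1 <= i < (size s).+2) 2 ^+ (psum (a :: b :: s) i - i) =
    2 ^+ a.-1 * (1 + \sum_(1 <= i < (size s).+1) 2 ^+ (psum (b :: s) i - i)) :> R.
  rewrite big_add1 /= big_nat_recl // E // psum0 [in RHS]big_add1 /= mulrDr.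
  congr (_ + _); rewrite mulr_sumr; apply: eq_big_nat => i /andP[_ i_s].
  by rewrite E // ltnS ltnW.
transitivity (1 + 2 ^+ a.-1 * tail_weight (b :: s)) => //.
rewrite IH // [size (a :: b :: s)]/= ES [(size s).+2.-1]/= E /=; last by lia.
by ring.
Qed.

(** Dropping [s_1] shifts the partial sums by one index, and the exponents [S_i - s_1 - (i-1)]
    become those of the tail. *)
Lemma coefE k s : size s = k.+2 -> all (leq 1) s ->
  coef R k.+2 s =
    2 ^+ (head 0%N s).-1 + (2 ^+ (head 0%N s).-1 - 1) * (tail_weight (behead s) - 1).
Proof.
case: s => [|a s] //= [Hs] /andP[a0 s0].
rewrite /coef tail_weightE ?Hs //= subn1; congr (_ + _ * _).
have E i : (psum (a :: s) i.+1 - a - i = psum s i - i)%N.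
  by rewrite /psum big_nat_recl //= addKn.
rewrite -[X in _ = X - 1]addrA [X in _ = X - 1]addrC addrK big_add1 /=.
rewrite subn2 /= E; congr (_ + _).
by apply: eq_bigr => i _; rewrite subn1 /= E.
Qed.

(* The coefficient of [x^d] in [f N] is the sum of the truncated multiple zeta
   values of depth [k] and weight [d + k], weighted by [om]. *)
Definition represents k (om : seq nat -> R) (f : nat -> fps R) :=
  forall N d, f N d = \sum_(s <- comps k (d + k)) om s * mzv_trunc R s N.

Lemma represents_ext k om om' f f' : (forall N, f N = f' N) ->
  (forall s, size s = k -> om s = om' s) -> represents k om f -> represents k om' f'.
Proof.
move=> ff oo H N d; rewrite -ff H big_seq [RHS]big_seq.
by apply: eq_bigr => s /size_comps /oo ->.
Qed.

Lemma represents_add k om om' f f' : represents k om f -> represents k om' f' ->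
  represents k (fun s => om s + om' s) (fun N => f N + f' N).
Proof.
move=> H H' N d; rewrite scoefD H H' -big_split /=.
by apply: eq_bigr => s _; rewrite mulrDl.
Qed.

(** The factor [g i.+1] chooses a new largest index [n_1 = i+1] with exponent [s_1 = a+1], and [f i]
    accounts for the indices below it. *)
Lemma represents_step k om f (phi : nat -> R) (g : nat -> fps R) :
  (forall i a, g i.+1 a = phi a * i.+1%:R ^- a.+1) ->
  represents k om f ->
  represents k.+1 (fun s => phi (head 0%N s).-1 * om (behead s))
    (fun N => \sum_(i < N) g i.+1 * f i).
Proof.
move=> gE fE N d; rewrite scoef_sum big_comps addnS -addSn big_split_ord /=.
(* Exponents with [a > d] leave weight less than [k] for the remaining [k] entries. *)
rewrite [X in _ = _ + X]big1 ?addr0; last first.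
  by move=> a _; rewrite comps_small ?big_nil //; have := ltn_ord a; lia.
rewrite exchange_big /=; apply: eq_bigr => a _.
have -> : (d.+1 + k - a.+1 = d - a + k)%N by have := ltn_ord a; lia.
under eq_bigr do rewrite fE mulr_sumr.
rewrite exchange_big /=; apply: eq_bigr => s _.
rewrite big_add1 /= big_mkord mulr_sumr; apply: eq_bigr => i _.
by rewrite gE; ring.
Qed.

Local Notation gx := (fpsC (@fpsX R)).
Local Notation gy := (@fpsX (fps R)).
(* Bivariate series: the outer variable is [y], the inner one is [x]. *)
Definition gd m : fps (fps R) := fpsC (fpsC m%:R^-1).
Definition gu m : fps (fps R) := fpsC (geo m%:R^-1 1).
Definition gv m : fps (fps R) := fpsC (geo m%:R^-1 2).
Definition gw m : fps (fps R) := geo (fpsC m%:R^-1) 1.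

Let mK m : (m.+1%:R : R)^-1 * m.+1%:R = 1.
Proof. by rewrite mulVf ?pnatr_eq0. Qed.

Lemma gdK m : gd m.+1 * m.+1%:R = 1.
Proof. by rewrite /gd -fpsC_nat -fpsC_nat -!fpsCM mK. Qed.

Lemma guK m : gu m.+1 * (m.+1%:R - gx) = 1.
Proof.
rewrite /gu -fpsC_nat -fpsCB -fpsCM -fpsC_nat -[@fpsX R]mul1r.
by rewrite -[1 in X in _ - X]/(fpsC 1) geoK.
Qed.

Lemma gvK m : gv m.+1 * (m.+1%:R - (gx + gx)) = 1.
Proof.
rewrite /gv -fpsC_nat -fpsCD -fpsCB -fpsCM -fpsC_nat.
rewrite (_ : fpsX + fpsX = fpsC 2 * fpsX) ?geoK //.
by rewrite fpsC_nat mulr_natl mulr2n.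
Qed.

Lemma gwK m : gw m.+1 * (m.+1%:R - gy) = 1.
Proof.
rewrite /gw -fpsC_nat -[gy]mul1r -[1 in X in _ - X]/(fpsC 1) geoK //.
by rewrite -fpsC_nat -fpsCM mK.
Qed.

Local Notation T k := (fun N => chain_gf gy gu N k).
Local Notation Om k := (fun N => weight_gf gy gu N k).

Lemma scoef_yCM k (c : fps R) (f : fps (fps R)) :
  (gy * fpsC c * f) k.+1 = c * f k.
Proof. by rewrite -mulrA scoefXMS scoefCM. Qed.

Lemma represents_chain k : represents k (fun=> 1) (T k).
Proof.
elim: k => [|k IH].
  move=> N d; rewrite addn0 (_ : chain_gf gy gu N 0%N = 1).
    by rewrite scoef1 /comps; case: eqP; rewrite ?big_nil // big_seq1 mulr1.
  elim: N => [|N IH]; first by rewrite /chain_gf big_ord0.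
  by rewrite chain_gfS scoefD IH /chain_top -!mulrA scoefXM0 addr0.
apply: represents_ext
  (represents_step (phi := fun=> 1) (g := fun m => geo m%:R^-1 1) _ IH).
- move=> N; have := sum_chain_top gy gu N => /esym/eqP; rewrite subr_eq => /eqP ->.
  rewrite scoefD addr0 scoef_sum; apply: eq_bigr => i _.
  by rewrite /chain_top scoef_yCM.
- by move=> s _; rewrite mulr1.
- by move=> i a; rewrite /= expr1n exprVn.
Qed.

Lemma weight_gf_y0 N : weight_gf gy gu N 0%N = 0.
Proof.
rewrite (weight_gf_rec gy guK gvK) -(sum_chain_top gy gu N) !scoefD !scoef_sum.
by rewrite !big1 ?addr0 // => i _; rewrite /chain_top -?mulrA scoefXM0.
Qed.

Lemma weight_gf_yS N k : weight_gf gy gu N k.+1 =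
  \sum_(i < N) geo i.+1%:R^-1 1 * chain_gf gy gu i k
  + \sum_(i < N) geo i.+1%:R^-1 1 * (k == 0%N)%:R
  + \sum_(i < N) geo i.+1%:R^-1 2 * weight_gf gy gu i k.
Proof.
rewrite (weight_gf_rec gy guK gvK) -(sum_chain_top gy gu N) !scoefD.
congr (_ + _ + _); rewrite scoef_sum; apply: eq_bigr => i _;
  rewrite /chain_top ?scoef_yCM //.
by rewrite scoefXMS mulr_natr.
Qed.

(** The terms of [weight_gf_rec] are the clauses of [tail_weight]: chains give 1, the depth-one sum
    gives the second 1 in [tail_weight [:: a] = 2], and the sum with [v] gives the factor
    [2^(a-1)]. *)
Lemma represents_weight k : represents k.+1 tail_weight (Om k.+1).
Proof.
have chainS j := represents_step (phi := fun=> 1) (g := fun m => geo m%:R^-1 1)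
  (fun i a => ltac:(by rewrite /= expr1n exprVn)) (represents_chain j).
elim: k => [|k IH].
  apply: represents_ext (represents_add (chainS 0%N) (chainS 0%N)).
    move=> N; rewrite weight_gf_yS [X in _ = _ + X]big1 ?addr0; last first.
      by move=> i _; rewrite weight_gf_y0 mulr0.
    congr (_ + _); apply: eq_bigr => i _; congr (_ * _).
    elim: (nat_of_ord i) => [|j IH]; first by rewrite /chain_gf big_ord0.
    by rewrite chain_gfS scoefD IH /chain_top -!mulrA scoefXM0 addr0.
  by case=> [|a [|b s]] //= _; rewrite mulr1.
apply: represents_ext (represents_add (chainS k.+1)
  (represents_step (phi := fun a => 2 ^+ a) (g := fun m => geo m%:R^-1 2) _ IH)).
- move=> N; rewrite weight_gf_yS /=; congr (_ + _).
  by rewrite [X in _ = _ + X]big1 ?addr0 // => i _; rewrite mulr0.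
- by case=> [|a [|b s]] //= _; rewrite mulr1.
- by move=> i a; rewrite /= exprVn.
Qed.

Definition total_gf N : fps (fps R) := diff_gf gy gu gv N + sum_gf gy gd gu N.

(** For [s_1 >= 2] the coefficient is [2^(s_1-1) - 1] times the tail weight, plus 1. Both summands
    are realised with weight 0 at [s_1 = 1], so divergent tuples drop out before any limit. *)
Lemma represents_total k :
  represents k.+2 (fun s => if (1 < head 0 s)%N then coef R k.+2 s else 0)
    (fun N => total_gf N k.+2).
Proof.
have Hd := represents_step (phi := fun a => 2 ^+ a - 1)
  (g := fun m => geo m%:R^-1 2 - geo m%:R^-1 1)
  (fun i a => ltac:(by rewrite /= expr1n mulrBl exprVn))
  (represents_weight k).
have Hs := represents_step (phi := fun a => (a != 0%N)%:R)
  (g := fun m => geo m%:R^-1 1 - fpsC m%:R^-1)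
  (fun i a => ltac:(by case: a => [|a];
     rewrite /= !expr1n !mul1r ?expr1 ?subrr ?mul0r ?subr0 ?exprVn)) (represents_chain k.+1).
have H := represents_add Hd Hs; move=> N d.
transitivity ((\sum_(i < N) (geo i.+1%:R^-1 2 - geo i.+1%:R^-1 1) * weight_gf gy gu i k.+1
  + \sum_(i < N) (geo i.+1%:R^-1 1 - fpsC i.+1%:R^-1) * chain_gf gy gu i k.+1) d).
  rewrite /total_gf scoefD /diff_gf /sum_gf; congr (scoef (_ + _) d).
    by rewrite scoef_sum; apply: eq_bigr => i _; rewrite -fpsCB scoef_yCM.
  by rewrite scoef_sum; apply: eq_bigr => i _; rewrite -fpsCB scoef_yCM.
rewrite H big_seq [RHS]big_seq; apply: eq_bigr => s s_in; congr (_ * _).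
have ss := size_comps s_in; have sp := comps_pos s_in.
rewrite (coefE ss sp); case: s ss sp {s_in} => // a s _ /= /andP[a0 _].
case: ifP => a1; last by rewrite (_ : a = 1%N) /=; [ring | lia].
rewrite (_ : (a.-1 != 0%N)) /=; last by lia.
by ring.
Qed.
End Weights.

(** * Passage to the limit *)

Section Limit.
Local Open Scope classical_set_scope.
Variable R : realType.
Local Notation gx := (fpsC (@fpsX R)).
Local Notation gy := (@fpsX (fps R)).
Local Notation gd := (@gd R).
Local Notation gu := (@gu R).
Local Notation gw := (@gw R).

Lemma normr_is_norm : is_norm (fun a : R => `|a|).
Proof.
split=> // [||a|a b|a b].
- by rewrite normr0.
- by rewrite normr1.
- by rewrite normrN.
- exact: ler_normD.
- by rewrite normrM.
Qed.

Definition xnorm L : fps R -> R := snorm (fun a : R => `|a|) 8^-1 L.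
Definition xynorm L : fps (fps R) -> R := snorm (xnorm L) 8^-1 L.

Lemma total_err_le k d : exists C : R, forall N,
  `|(csum_err gx gy gd gu gw N.+1 - diff_err gy gd gu N.+1) k d| <= C / root4 R N.+1.
Proof.
(* The truncation degree [L] exceeds both [k] and [d], so the norm controls this coefficient up to
   the factor [r^(k+d)]. *)
pose L := (k + d).+1; pose r : R := 8^-1.
have r0 : 0 <= r by rewrite invr_ge0.
have r1 : r < 1 by rewrite invf_lt1 // ltr1n.
have L0 : (0 < L)%N by [].
have xP : is_norm (xnorm L) by exact: snormP normr_is_norm _ _.
have xyP : is_norm (xynorm L) by exact: snormP xP _ _.
have inv m i : `|(m.+1%:R^-1 : R) ^+ i.+1| <= m.+1%:R^-1 ^+ i.+1.
  by rewrite ger0_norm // exprn_ge0.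
have He N : xynorm L (csum_err gx gy gd gu gw N.+1 - diff_err gy gd gu N.+1)
    <= 80 / root4 R N.+1.
  apply: (nrm_total_err (norm_ge0 xyP) (norm_0 xyP) (norm_1 xyP) (norm_N xyP)
    (norm_D xyP) (norm_M xyP)).
  - by rewrite /xynorm snormC //; apply: snormX_le normr_is_norm _ _.
  - exact: snormX_le xP _ _.
  - move=> m; rewrite /xynorm snormC // /xnorm snormC //; last exact: normr_is_norm.
    by rewrite ger0_norm ?invr_ge0.
  - by move=> m; rewrite /xynorm snormC //; apply: snorm_geo.
  - move=> m; apply: snorm_geo => // i.
    by rewrite fpsCX /xnorm snormC //; exact: normr_is_norm.
exists (80 / r ^+ d / r ^+ k) => N.
set e := _ - _; have := He N; rewrite -/e => {}He.
have rp : 0 < r by rewrite invr_gt0.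
have H1 := scoef_le_snorm xP r0 e (ltac:(rewrite /L; lia) : (k < L)%N).
have H2 := scoef_le_snorm normr_is_norm r0 (e k) (ltac:(rewrite /L; lia) : (d < L)%N).
rewrite mulrAC ler_pdivlMr ?exprn_gt0 // mulrAC ler_pdivlMr ?exprn_gt0 //.
rewrite mulrAC; apply: le_trans (ler_wpM2r _ H2) _; first by rewrite exprn_ge0.
exact: le_trans H1 He.
Qed.

Lemma mzv_trunc1 n N : mzv_trunc R [:: n] N = \sum_(m < N) m.+1%:R^-1 ^+ n.
Proof.
rewrite /= big_add1 /= big_mkord.
by apply: eq_bigr => m _; rewrite mulr1 exprVn.
Qed.

(** With [a = 1/m], the three terms of the summand contribute [1], [d+1] and [k+1] copies of
    [a^(d+k+3)], the last two through the squares; together they give the weight [d+k+3]. *)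
Lemma main_gf_coef N k d :
  main_gf gy gu gw N k.+1 d = (d + k.+3)%:R * mzv_trunc R [:: d + k.+3]%N N.
Proof.
rewrite mzv_trunc1 /main_gf !scoef_sum mulr_sumr; apply: eq_bigr => m _.
set a : R := m.+1%:R^-1; rewrite !scoefD scoefXMS scoefD.
have uwE (f : fps (fps R)) (j : nat) (g : fps R) (c : R) :
  f j = fpsC c -> (fpsC g * f) j d = c * g d.
  by move=> fj; rewrite scoefCM fj mulrC scoefCM.
rewrite (@uwE _ _ _ (a ^+ k.+2)); last by rewrite /gw /= expr1n mul1r fpsCX.
rewrite /gu fpsCX [gw _ * _]mulrC [gw _ ^+ 2 * _]mulrC.
rewrite (@uwE _ _ _ (a ^+ k.+1)); last by rewrite /gw /= expr1n mul1r fpsCX.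
rewrite (@uwE _ _ _ (k.+1%:R * a ^+ k.+2)); last first.
  by rewrite /gw geo_sqr fpsCX -fpsC_nat -fpsCM.
rewrite geo_sqr /= expr1n mul1r.
have -> : a ^+ (d + k.+3) = a ^+ d.+1 * a ^+ k.+2 by rewrite -exprD; congr (_ ^+ _); lia.
rewrite (_ : a ^+ k.+1 * _ = d.+1%:R * (a ^+ d.+1 * a ^+ k.+2)); last first.
  by rewrite [a ^+ k.+2]exprS [a ^+ d.+2]exprS; ring.
have -> : (d + k.+3)%:R = 1 + d.+1%:R + k.+1%:R :> R.
  by rewrite nat1r -natrD; congr (_%:R); lia.
by ring.
Qed.

Lemma total_gf_coef N k d :
  total_gf R N k.+2 d.+1 = (d + k.+3)%:R * mzv_trunc R [:: d + k.+3]%N N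
    + (csum_err gx gy gd gu gw N - diff_err gy gd gu N) k.+1 d.
Proof.
rewrite -main_gf_coef -!scoefD /total_gf (total_gfE (@gdK R) (@guK R) (@gvK R) (@gwK R)).
by rewrite -mulrA scoefCM !scoefXMS -[in LHS]addrA.
Qed.

(** * Convergence of the truncated sums *)

Lemma mzv_trunc_ge0 s N : 0 <= mzv_trunc R s N.
Proof.
elim: s N => //= a s IH N; apply: sumr_ge0 => m _.
by rewrite mulr_ge0 // invr_ge0 exprn_ge0.
Qed.

Lemma mzv_trunc_homo s : {homo mzv_trunc R s : m n / (m <= n)%N >-> m <= n}.
Proof.
case: s => [|a s] m n mn //=.
rewrite [leRHS](big_cat_nat _ (n := m.+1)) //= lerDl.
by apply: sumr_ge0 => i _; rewrite mulr_ge0 ?mzv_trunc_ge0 // invr_ge0 exprn_ge0.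
Qed.

Lemma mzv_trunc_cvg s M : (forall N, mzv_trunc R s N <= M) ->
  mzv_trunc R s @ \oo --> mzv R s.
Proof.
move=> sM; apply: nondecreasing_is_cvgn; first by move=> m n; exact: mzv_trunc_homo.
by exists M => _ [N _ <-].
Qed.

Lemma root4_inv_cvg0 : (root4 R n.+1)^-1 @[n --> \oo] --> (0 : R).
Proof.
rewrite (_ : (fun n => _) = (fun n => Num.sqrt (Num.sqrt (@harmonic R n)))).
  rewrite -[X in _ --> X](sqrtr0 R) -[in X in _ --> X](sqrtr0 R).
  apply: continuous_cvg; first exact: sqrt_continuous.
  apply: continuous_cvg; first exact: sqrt_continuous.
  exact: cvg_harmonic.
by apply/funext => n; rewrite /root4 -!sqrtrV // sqrtr_ge0.
Qed.

Lemma zeta_trunc_cvg n : (1 < n)%N -> mzv_trunc R [:: n] @ \oo --> zeta R n.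
Proof.
move=> n1; apply: (mzv_trunc_cvg (M := 2)) => N; rewrite mzv_trunc1.
apply: le_trans (sum_inv_sqr_le2 R N); apply: ler_sum => m _.
by rewrite ler_wiXn2l // ?invr_ge0 // invf_le1 ?ler1n.
Qed.

Definition admissible_sum k n N : R :=
  \sum_(s <- comps k n | (1 < head 0 s)%N) coef R k s * mzv_trunc R s N.

Lemma admissible_sumE k d N :
  admissible_sum k.+2 (d.+1 + k.+2) N = total_gf R N k.+2 d.+1.
Proof.
rewrite represents_total /admissible_sum big_mkcond /=; apply: eq_bigr => s _.
by case: ifP; rewrite ?mul0r.
Qed.

Lemma admissible_sum_cvg k d :
  admissible_sum k.+2 (d.+1 + k.+2) N @[N --> \oo]
  --> (d + k.+3)%:R * zeta R (d + k.+3).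
Proof.
rewrite -cvg_shiftS /=.
under eq_fun do rewrite admissible_sumE total_gf_coef.
rewrite -[_ * zeta _ _]addr0; apply: cvgD.
  apply: cvgMl_tmp; rewrite (cvg_shiftS (mzv_trunc R [:: d + k.+3]%N)).
  by apply: zeta_trunc_cvg; lia.
have [C HC] := total_err_le k.+1 d.
apply: norm_cvg0; apply: (squeeze_cvgr (f := cst 0) (h := fun N => C / root4 R N.+1)).
- by near=> N; rewrite normr_ge0 HC.
- exact: cvg_cst.
- by rewrite -(mulr0 C); apply: cvgMl_tmp; exact: root4_inv_cvg0.
Unshelve. all: by end_near. Qed.

Lemma coef_ge1 k s : 1 <= coef R k s.
Proof.
have p1 (i : nat) : 1 <= 2 ^+ i :> R by rewrite exprn_ege1 // ler1n.
rewrite /coef; apply: le_trans (p1 (nth 0%N s 0 - 1)%N) _; rewrite lerDl.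
apply: mulr_ge0; first by rewrite subr_ge0.
by rewrite addr_ge0 ?exprn_ge0 // sumr_ge0 // => i _; rewrite exprn_ge0.
Qed.

(** Coefficients are at least 1 and all terms nonnegative; this transfers boundedness from the total
    to each single truncated sum. *)
Lemma mzv_trunc_le_admissible_sum k n s N : s \in comps k n -> (1 < head 0 s)%N ->
  mzv_trunc R s N <= admissible_sum k n N.
Proof.
move=> s_in s1; rewrite /admissible_sum (big_rem s) //= s1.
rewrite -[leLHS]addr0; apply: lerD.
  by rewrite ler_peMl ?mzv_trunc_ge0 ?coef_ge1.
apply: sumr_ge0 => t _; rewrite mulr_ge0 ?mzv_trunc_ge0 //.
exact: le_trans ler01 (coef_ge1 _ _).
Qed.
End Limit.

Theorem theorem1p1 (R : realType) (k n : nat) :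
  (2 <= k)%N -> (k.+1 <= n)%N ->
  \sum_(t : k.-tuple 'I_n.+1 |
          [&& all (fun x : 'I_n.+1 => (0 < x)%N) t,
              (1 < nth 0%N (map val t) 0)%N &
              sumn (map val t) == n])
     coef R k (map val t) * mzv R (map val t)
  = n%:R * zeta R n.
Proof.
case: k => [|[|k]] // _ kn.
pose F s := if (1 < head 0 s)%N then coef R k.+2 s * mzv R s else 0.
transitivity (\sum_(s <- comps k.+2 n) F s).
  rewrite -(big_tuple_comps k.+2 F (ltnSn n)) [RHS]big_mkcond [LHS]big_mkcond /=.
  apply: eq_bigr => t _; rewrite /F nth0.
  by case: (all _ t) => //=; case: (sumn _ == n); rewrite ?andbT ?andbF.
(* [d+1] is weight minus depth, positive because [n] exceeds the depth. *)
have [d nE] : exists d, n = (d.+1 + k.+2)%N by exists (n - k.+3)%N; lia.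
have lim := @admissible_sum_cvg R k d; rewrite -nE in lim.
have nE' : (d + k.+3)%N = n by lia.
rewrite nE' in lim.
rewrite -(cvg_lim (@Rhausdorff R) lim); apply/esym/cvg_lim; first exact: Rhausdorff.
rewrite /F -big_mkcond big_seq_cond.
under eq_fun do rewrite /admissible_sum big_seq_cond.
apply: cvg_big; first exact: add_continuous.
move=> s /andP[s_in s1]; apply: cvgMl_tmp.
(* The convergent total is bounded and dominates the truncations of each admissible [s], so each of
   these converges. The bound holds for reals strictly above [M], hence [M + 1]. *)
have [M [_ HM]] := cvg_seq_bounded (cvgP _ lim).
apply: (mzv_trunc_cvg (M := M + 1)) => N.
apply: le_trans (mzv_trunc_le_admissible_sum R N s_in s1) _.
have M1 : M < M + 1 by rewrite ltrDl.
exact: le_trans (ler_norm _) (HM _ M1 N I).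
Qed.
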